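(* Let $a_n > 0$ and $b_n > 0$ in $*G$, evaluated at infinite $n$, and let $L \in \overline{\mathbb{R}}$ be the realization of $\frac{a_n}{b_n}|_{n=\infty}$. Then $\frac{a_n}{b_n}|_{n=\infty} \; z_1 \; 1 \Leftrightarrow a_n \; z_2 \; b_n|_{n=\infty}$ for the following pairs of relations: (i) $L < 1$ if and only if $a_n < b_n$ and $a_n \not\sim b_n$ in $*G$; (ii) $L > 1$ if and only if $a_n > b_n$ and $a_n \not\sim b_n$ in $*G$; (iii) $L = 1$ if and only if $a_n \sim b_n$ in $*G$.
   Context: $*G$ denotes the gossamer number system: numbers built from the finite integers together with infinite integers (integers larger in magnitude than every finite integer) in the same way that the reals are built from the integers. It is taken to be a totally ordered field containing the ordered field $\mathbb{R}$ as a subfield and containing infinite numbers. A number in $*G$ is a positive (negative) infinity if it is larger (smaller) than every real number; $\Phi^{-1}$ is the set of all infinities, and $\Phi = \{x \in *G\setminus\{0\}: 1/x \in \Phi^{-1}\}$ is the set of infinitesimals. The notation $|_{n=\infty}$ means that the expression is evaluated at a positive infinite integer $n$; the statement concerns the values $a_n, b_n\in *G$ there. $a \simeq b$ means $a - b \in \Phi \cup \{0\}$; $f \sim g$ means $g\neq 0$ and $f/g \simeq 1$. $\overline{\mathbb{R}} = \mathbb{R} \cup \{\pm\infty\}$. The evaluation of the fraction is a limit, i.e. a transfer $*G \mapsto \mathbb{R}/\overline{\mathbb{R}}$: a positive (negative) infinity is realized as $+\infty$ ($-\infty$), and any other element $a$ is realized as its standard part, the unique real $r$ with $a \simeq r$.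 The inequality in $*G$ carries the condition $\not\sim$, under which $( *G,<)\mapsto(\mathbb{R}/\overline{\mathbb{R}},<)$ and $( *G,>)\mapsto(\mathbb{R}/\overline{\mathbb{R}},>)$; the relation $\sim$ corresponds to the case that is not one of the other two. *)

(* Defs.v *)
From HB Require Import structures.
From mathcomp Require Import all_boot all_order all_algebra.
From mathcomp Require Import boolp classical_sets reals constructive_ereal.

Set Implicit Arguments.
Unset Strict Implicit.
Unset Printing Implicit Defensive.

Import Order.TTheory GRing.Theory Num.Theory.
Local Open Scope classical_set_scope.
Local Open Scope ring_scope.

(* [G] plays the role of *G, and [iota] is the inclusion of the reals in *G.
   That [iota] preserves the order and that [G] has infinite elements are
   hypotheses of the theorem, not part of these definitions. *)
Section Gossamer.
Context {R : realType} {G : realFieldType} (iota : {rmorphism R -> G}).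
Implicit Types x y f g : G.

Definition pos_infinity x : Prop := forall r : R, iota r < x.
Definition neg_infinity x : Prop := forall r : R, x < iota r.

(* Phi^-1 *)
Definition infinities : set G := [set x | pos_infinity x \/ neg_infinity x].

(* Phi *)
Definition infinitesimals : set G := [set x | x != 0 /\ infinities x^-1].

Definition infinitely_close x y : Prop := (infinitesimals `|` [set 0]) (x - y).

Definition asymptotic f g : Prop := g != 0 /\ infinitely_close (f / g) 1.

(* For a finite [x] there is exactly one real infinitely close to it; the
   default value 0 is then irrelevant. *)
Definition standard_part x : R := xget 0 [set r | infinitely_close x (iota r)].

(* The transfer from *G to the extended reals. *)
Definition realization x : \bar R :=
  if `[< pos_infinity x >] then +oo%E
  else if `[< neg_infinity x >] then -oo%E
  else (standard_part x)%:E.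

End Gossamer.

(* Main.v *)
Require Import Defs.
From HB Require Import structures.
From mathcomp Require Import all_boot all_order all_algebra.
From mathcomp Require Import boolp classical_sets reals constructive_ereal.
From mathcomp Require Import lra.

Import Order.TTheory GRing.Theory Num.Theory.
Local Open Scope classical_set_scope.
Local Open Scope ring_scope.

(** Put x = a / b. By completeness of the reals every finite x is infinitely
close to the supremum of the reals below it, so the transfer of x is infinite
or a real r with x infinitely close to r. If r differs from 1, the gap |r - 1|
is a positive real, so x lies strictly on the same side of 1 as r and is not
infinitely close to 1. This gives the three implications from L to a and b;
the converses follow because their conclusions exclude one another while
L < 1, L > 1 and L = 1 exhaust all cases. *)

Section Gossamer_theory.
Set Implicit Arguments.
Unset Strict Implicit.
Context {R : realType} {G : realFieldType} (iota : {rmorphism R -> G}).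
Hypothesis iota_le : {mono iota : x y / x <= y}.
Implicit Types (x y : G) (r s e : R).

Let iota_lt : {mono iota : x y / x < y} := leW_mono iota_le.

(** Inversion exchanges being smaller than every positive real with being larger than every real;
    this gives an epsilon form that suits linear arithmetic. The difference 0, which has no such
    inverse, is treated apart. *)
Lemma infinitely_closeP x y :
  infinitely_close iota x y <-> forall e, 0 < e -> `|x - y| < iota e.
Proof.
rewrite /infinitely_close; move: (x - y) => z; split.
  have iota_gt0 e : 0 < e -> 0 < iota e by rewrite -(rmorph0 iota) iota_lt.
  case=> [[z0 inf_z] e e0|-> e e0]; last by rewrite normr0 iota_gt0.
  have z_gt0 : 0 < `|z| by rewrite normr_gt0.
  rewrite -ltf_pV2 ?posrE ?iota_gt0 // -normfV -fmorphV.
  case: inf_z => [/(_ e^-1)|/(_ (- e^-1))]; rewrite ?rmorphN.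
    by move=> /lt_le_trans; apply; exact: ler_norm.
  by rewrite ltrNr => /lt_le_trans; apply; rewrite -normrN ler_norm.
move=> small; have [->|z0] := eqVneq z 0; [by right | left; split=> //].
(* Inverting [small] at [r^-1] needs [0 < r]; other [r] are trivial. The sign of [z^-1] then decides
   which infinity it is. *)
have big r : iota r < `|z^-1|.
  have [r0|r0] := leP r 0.
    apply: (@le_lt_trans _ _ 0); rewrite ?normr_gt0 ?invr_eq0 //.
    by rewrite -(rmorph0 iota) iota_le.
  have ir0 : 0 < iota r by rewrite -(rmorph0 iota) iota_lt.
  rewrite normfV -[iota r]invrK ltf_pV2 ?posrE ?invr_gt0 ?normr_gt0 //.
  by rewrite -fmorphV small // invr_gt0.
have [zp|zn] := leP 0 z^-1; [left|right] => r.
  by have := big r; rewrite ger0_norm.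
by have := big (- r); rewrite ltr0_norm // rmorphN ltrN2.
Qed.

Lemma finite_infinitely_close x : ~ pos_infinity iota x ->
  ~ neg_infinity iota x -> exists r, infinitely_close iota x (iota r).
Proof.
move=> /existsNP[u /negP]; rewrite -leNgt => xu.
move=> /existsNP[l /negP]; rewrite -leNgt => lx.
pose A := [set r | iota r <= x].
have ubA s : x <= iota s -> ubound A s.
  by move=> xs r /= rx; rewrite -iota_le (le_trans rx).
have supA : has_sup A by split; [exists l | exists u; exact: ubA].
exists (sup A); apply/infinitely_closeP => e e0.
rewrite ltr_norml; apply/andP; split.
  (* Some element of [A] exceeds [sup A - e], and its image is at most [x]. *)
  have [r /= rx ltr] := sup_adherent e0 supA.
  move: ltr; rewrite -iota_lt rmorphB => ltr; rewrite /A /= in rx; lra.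
(* Otherwise [e + sup A] would itself belong to [A]. *)
rewrite ltrBlDr -rmorphD ltNge; apply/negP => le_x.
have : e + sup A <= sup A := sup_upper_bound supA le_x.
by lra.
Qed.

(** Neighbourhoods of [r] and [s] of radius half the gap are disjoint. With [x] or [y] a real this
    compares with that real; with [x = y] it shows that the close real is unique. *)
Lemma infinitely_close_lt x y r s : infinitely_close iota x (iota r) ->
  infinitely_close iota y (iota s) -> r < s -> x < y.
Proof.
move=> /infinitely_closeP xr /infinitely_closeP ys rs.
have e0 : 0 < (s - r) / 2 by lra.
have : iota s = iota r + iota ((s - r) / 2) *+ 2.
  by rewrite -rmorphMn -rmorphD /=; congr (iota _); rewrite mulr2n; lra.
move: (xr _ e0) (ys _ e0); rewrite !ltr_norml => /andP[_ ?] /andP[? _]; lra.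
Qed.

Lemma infinitely_close_refl x : infinitely_close iota x x.
Proof. by right; rewrite /= subrr. Qed.

Variant realization_spec x : \bar R -> Prop :=
| RealizationPos of pos_infinity iota x : realization_spec x +oo%E
| RealizationNeg of neg_infinity iota x : realization_spec x -oo%E
| RealizationFin r of infinitely_close iota x (iota r) :
    realization_spec x r%:E.

Lemma realizationP x : realization_spec x (realization iota x).
Proof.
rewrite /realization; case: asboolP => [|npos]; first exact: RealizationPos.
case: asboolP => [|nneg]; first exact: RealizationNeg.
apply: RealizationFin.
have := finite_infinitely_close npos nneg.
(* Since a close real exists, the default 0 of [standard_part] is not taken. *)
exact: (@xgetPex _ 0 [set r | infinitely_close iota x (iota r)]).
Qed.

Lemma pos_infinity_not_close x r :
  pos_infinity iota x -> ~ infinitely_close iota x (iota r).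
Proof.
(* Closeness to [r] would put [x] below the real [r + 1]. *)
move=> pos xr; have r1 : r < r + 1 by lra.
have := infinitely_close_lt xr (infinitely_close_refl (iota (r + 1))) r1.
by rewrite ltNge (ltW (pos _)).
Qed.

Lemma neg_infinity_not_close x r :
  neg_infinity iota x -> ~ infinitely_close iota x (iota r).
Proof.
move=> neg xr; have r1 : r - 1 < r by lra.
have := infinitely_close_lt (infinitely_close_refl (iota (r - 1))) xr r1.
by rewrite ltNge (ltW (neg _)).
Qed.

Lemma realization_lt x r : (realization iota x < r%:E)%E ->
  x < iota r /\ ~ infinitely_close iota x (iota r).
Proof.
case: realizationP => [//|neg _|s xs];
  first by split; [|exact: neg_infinity_not_close].
rewrite lte_fin => sr; split.
  exact: infinitely_close_lt xs (infinitely_close_refl _) sr.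
by move=> xr; have := infinitely_close_lt xs xr sr; rewrite ltxx.
Qed.

Lemma realization_gt x r : (r%:E < realization iota x)%E ->
  iota r < x /\ ~ infinitely_close iota x (iota r).
Proof.
case: realizationP => [pos _|//|s xs];
  first by split; [|exact: pos_infinity_not_close].
rewrite lte_fin => rs; split.
  exact: infinitely_close_lt (infinitely_close_refl _) xs rs.
by move=> xr; have := infinitely_close_lt xr xs rs; rewrite ltxx.
Qed.

Lemma realization_eq x r :
  realization iota x = r%:E -> infinitely_close iota x (iota r).
Proof. by case: realizationP => // s xs [<-]. Qed.

End Gossamer_theory.

(* [a] and [b] are the values in *G of a_n and b_n at an infinite n. *)
Theorem theorem4p7 (R : realType) (G : realFieldType)
    (iota : {rmorphism R -> G})
    (iota_le : {mono iota : x y / x <= y})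
    (G_infinite : infinities iota !=set0)
    (a b : G) (a_gt0 : 0 < a) (b_gt0 : 0 < b)
    (L : \bar R) (L_def : L = realization iota (a / b)) :
  [/\ (L < 1%:E)%E <-> (a < b /\ ~ asymptotic iota a b),
      (L > 1%:E)%E <-> (a > b /\ ~ asymptotic iota a b)
    & L = 1%:E <-> asymptotic iota a b].
Proof.
have asymE : asymptotic iota a b <-> infinitely_close iota (a / b) (iota 1).
  by rewrite /asymptotic rmorph1 gt_eqF //; split=> [[]|].
(* Multiplying by [b > 0] preserves the order. *)
have lt_ab : (a / b < iota 1) = (a < b) by rewrite rmorph1 ltr_pdivrMr ?mul1r.
have gt_ab : (iota 1 < a / b) = (b < a) by rewrite rmorph1 ltr_pdivlMr ?mul1r.
have := @realization_lt _ _ _ iota_le (a / b) 1.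
have := @realization_gt _ _ _ iota_le (a / b) 1.
have := @realization_eq _ _ _ iota_le (a / b) 1.
rewrite -L_def lt_ab gt_ab -asymE => Leq Lgt Llt.
split; split=> //.
- move=> [ab nasym]; case: (ltgtP L 1%:E) => // [/Lgt[ba _]|/Leq//].
  by move: ab; rewrite ltNge (ltW ba).
- move=> [ba nasym]; case: (ltgtP L 1%:E) => // [/Llt[ab _]|/Leq//].
  by move: ab; rewrite ltNge (ltW ba).
- by move=> asym; case: (ltgtP L 1%:E) => // [/Llt[]|/Lgt[]].
Qed.
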